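(* Fix an integer $n\geq 1$ and let $G=\mathrm{Gal}(\mathbb{Q}(X_{n-1})/\mathbb{Q})$. For each $s=(s_\sigma)_{\sigma\in G}\in\{1,-1\}^{G}$ choose $a_s\in\mathbb{Z}[X_{n-1}]$ with $\|\mu_s(X_n)-\mu(a_s)\|=\min\{\|\mu_s(X_n)-\mu(a)\|: a\in\mathbb{Z}[X_{n-1}]\}$, and for $\sigma\in G$ set $$b_{s,\sigma}=\frac{2\sigma(X_n)}{|s_\sigma\sigma(X_n)-\sigma(a_s)|},\qquad C_{s,\sigma}=\log\left(\sqrt{b_{s,\sigma}^2+1}+|b_{s,\sigma}|\right).$$ If $\varepsilon\in RE_n^+$ satisfies $q(\varepsilon)\mid p(\varepsilon)-1$ in $\mathbb{Z}[X_{n-1}]$ and $p(\varepsilon)q(\varepsilon)>0$, then there exists $\sigma\in G$ such that $\bigl|\log|\sigma(\varepsilon)|\bigr|\leq C_{s,\sigma}$, where $s=(\mathrm{sgn}(\sigma(p(\varepsilon)q(\varepsilon))))_{\sigma\in G}$.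
   Context: For $m\geq 0$ let $X_m=2\cos(2\pi/2^{m+2})$ (so $X_0=0$ and $X_m=\sqrt{2+X_{m-1}}$), viewed as real numbers; $\mathbb{Z}[X_m]$ is the ring of integers of the totally real field $\mathbb{Q}(X_m)$, and $\mathrm{Gal}(\mathbb{Q}(X_{n-1})/\mathbb{Q})$ has order $2^{n-1}$. Every $x\in\mathbb{Z}[X_n]$ can be written uniquely as $x=p(x)+X_nq(x)$ with $p(x),q(x)\in\mathbb{Z}[X_{n-1}]$; $RE_n^+=\{\varepsilon\in\mathbb{Z}[X_n]: p(\varepsilon)^2-X_n^2q(\varepsilon)^2=1\}$. Each $\sigma\in\mathrm{Gal}(\mathbb{Q}(X_{n-1})/\mathbb{Q})$, viewed as a real embedding, is extended to $\mathbb{Q}(X_n)$ by setting $\sigma(X_n)=\sqrt{2+\sigma(X_{n-1})}>0$; thus $\sigma(\varepsilon)=\sigma(p(\varepsilon))+\sigma(X_n)\sigma(q(\varepsilon))$. Define $\mu:\mathbb{Q}(X_{n-1})\to\mathbb{R}^{G}$ by $\mu(x)=(\sigma(x))_{\sigma\in G}$ and, for $s\in\{1,-1\}^G$, $\mu_s(X_n)=(s_\sigma\sigma(X_n))_{\sigma\in G}\in\mathbb{R}^G$; $\|\cdot\|$ is the Euclidean norm on $\mathbb{R}^G$. *)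

(* Defs.v *)
From HB Require Import structures.
From mathcomp Require Import all_boot all_order all_algebra all_field.
From mathcomp Require Import all_classical all_reals all_analysis.
From mathcomp Require Import ring.

Set Implicit Arguments.
Unset Strict Implicit.
Unset Printing Implicit Defensive.

Import Order.TTheory GRing.Theory Num.Theory.

Local Open Scope ring_scope.

Definition X_ (R : realType) (m : nat) : R := 2 * cos (2 * pi / 2 ^+ (m + 2)).

(** [chebQ m] is the monic integer polynomial of degree [2 ^ m] with
    [chebQ m (2 cos t) = 2 cos (2 ^ m t)]; its roots are the conjugates of
    [X_ R m].  It is only used to construct the field Q(X_m). *)
Fixpoint chebQ (m : nat) : {poly rat} :=
  if m is m'.+1 then chebQ m' ^+ 2 - 2%:P else 'X.

(** [dickson k (2 cos t) = 2 cos (k t)]. *)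
Fixpoint dickson_pair (k : nat) : {poly rat} * {poly rat} :=
  if k is k'.+1 then
    let: (u, v) := dickson_pair k' in (v, 'X * v - u)
  else (2%:P, 'X).

Lemma sinpin (R : realType) k : sin (pi *+ k : R) = 0.
Proof.
elim: k => [|k IH]; first by rewrite mulr0n sin0.
by rewrite mulrSr sinDpi IH oppr0.
Qed.

Section QXExistence.
Variable R : realType.
Local Notation emb := (map_poly (@ratr R)).

Lemma chebQ_cos m (t : R) :
  (emb (chebQ m)).[2 * cos t] = 2 * cos (2 ^+ m * t).
Proof.
elim: m t => [|m IH] t /=; first by rewrite map_polyX hornerX expr0 mul1r.
rewrite rmorphB rmorphXn /= map_polyC /= hornerD hornerN hornerC horner_exp IH.
have -> : 2 ^+ m.+1 * t = (2 ^+ m * t) *+ 2 by rewrite exprS -mulrA mulr_natl.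
rewrite cos_mulr2n rmorph_nat; ring.
Qed.

Lemma chebQ_size m : size (chebQ m) = (2 ^ m).+1 /\ chebQ m \is monic.
Proof.
elim: m => [|m [IHs IHm]] /=; first by rewrite size_polyX monicX.
have sz : size (chebQ m ^+ 2) = (2 ^ m.+1).+1.
  have nz : chebQ m ^+ 2 != 0 by rewrite monic_neq0 // monic_exp.
  by rewrite (polySpred nz) size_exp IHs /= expnS mulnC.
have lt2 : (size (- (2%:P : {poly rat})) < size (chebQ m ^+ 2))%N.
  rewrite size_polyN sz (leq_ltn_trans (size_polyC_leq1 _)) //.
  by rewrite ltnS expn_gt0.
rewrite size_polyDl // sz; split=> //.
by rewrite monicE lead_coefDl // -monicE monic_exp.
Qed.

Lemma dickson_cos k (t : R) :
  (emb (dickson_pair k).1).[2 * cos t] = 2 * cos (k%:R * t) /\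
  (emb (dickson_pair k).2).[2 * cos t] = 2 * cos (k.+1%:R * t).
Proof.
elim: k => [|k [IH1 IH2]] /=.
  by rewrite map_polyC map_polyX /= hornerC hornerX rmorph_nat mul0r cos0 mul1r mulr1.
case E : (dickson_pair k) IH1 IH2 => [u v] /= IH1 IH2; split=> //.
rewrite rmorphB rmorphM /= map_polyX hornerD hornerN hornerM hornerX IH1 IH2.
have -> : k.+2%:R * t = k.+1%:R * t + t by rewrite -[k.+2]addn1 natrD mulrDl mul1r.
have -> : k%:R * t = k.+1%:R * t - t by rewrite -[k.+1]addn1 natrD mulrDl mul1r addrK.
by rewrite cosB cosD; ring.
Qed.

(** Q(X_m): a Galois extension of Q generated by an element that a real
    embedding sends to [X_ R m]. *)
Lemma QX_exists (m : nat) :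
  {L : splittingFieldType rat &
  {iota : {rmorphism L -> R} &
  {x : L | iota x = X_ R m & <<1; x>>%VS = fullv}}}.
Proof.
pose P q := (q != 0) && root (emb q) (X_ R m).
have ang0 : 2 ^+ m * (2 * pi / 2 ^+ (m + 2)) = pi / 2 :> R.
  by rewrite exprD; field; rewrite expf_neq0.
have rootcheb : root (emb (chebQ m)) (X_ R m).
  by rewrite rootE /X_ chebQ_cos ang0 cos_pihalf mulr0.
have nzcheb : chebQ m != 0 by rewrite -size_poly_eq0 (chebQ_size m).1.
have exP : exists n, `[< exists q, P q /\ size q = n >].
  exists (2 ^ m).+1; apply/asboolP; exists (chebQ m).
  by rewrite /P nzcheb rootcheb (chebQ_size m).1.
have [p [/andP[nz_p pz0] minp]] : {p : {poly rat} | P p /\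
    forall q, P q -> (size p <= size q)%N}.
  apply: cid; case: (ex_minnP exP) => n /asboolP[q [Pq <-]] minn.
  exists q; split=> // r Pr; apply: minn; apply/asboolP; by exists r.
have irr_p : irreducible_poly p.
  apply/(subfx_irreducibleP pz0 nz_p) => q rq nzq; apply: minp.
  by rewrite /P nzq.
pose L : fieldExtType rat := SubFieldExtType pz0 irr_p.
pose iota : {rmorphism L -> R} := @subfx_inj _ _ (@ratr R) (X_ R m) p.
pose x : L := subfx_root (@ratr R) (X_ R m) p.
have iotax : iota x = X_ R m by apply: subfx_inj_root.
have iotaQ (q : {poly rat}) : map_poly iota (map_poly (in_alg L) q) = emb q.
  rewrite -map_poly_comp; apply: eq_map_poly => a /=.
  exact: (subfx_inj_base pz0 nz_p a).
have iota_ev (q : {poly rat}) (y : L) :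
    iota (map_poly (in_alg L) q).[y] = (emb q).[iota y].
  by rewrite -horner_map iotaQ.
have inj_iota : injective iota by apply: fmorph_inj.
have Qin (q : {poly rat}) : map_poly (in_alg L) q \is a polyOver 1%VS.
  by apply/polyOverP=> i; rewrite coef_map memvZ ?mem1v.
have gen_x : <<1; x>>%VS = fullv.
  apply/vspaceP=> y; rewrite memvf; apply/Fadjoin_polyP.
  have [q ->] := subfxEroot pz0 nz_p y.
  by exists (map_poly (in_alg L) q); first exact: Qin.
pose r j : L := (map_poly (in_alg L) (dickson_pair j.*2.+1).1).[x].
have iota_r j : iota (r j) = 2 * cos (j.*2.+1%:R * (2 * pi / 2 ^+ (m + 2))).
  by rewrite iota_ev iotax /X_ (dickson_cos _ _).1.
pose rs := [seq r j | j <- seq.iota 0 (2 ^ m)].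
have root_rs j : root (map_poly (in_alg L) (chebQ m)) (r j).
  rewrite rootE -(inj_eq inj_iota) iota_ev rmorph0 iota_r chebQ_cos.
  rewrite mulrCA ang0.
  have -> : j.*2.+1%:R * (pi / 2) = pi *+ j + pi / 2 :> R.
    by rewrite -natr1 -muln2 natrM -mulr_natl; field.
  by rewrite cosDpihalf sinpin oppr0 mulr0.
have ang_itv j : (j < 2 ^ m)%N ->
    j.*2.+1%:R * (2 * pi / 2 ^+ (m + 2)) \in (`[0, pi] : interval R).
  move=> ltj; rewrite in_itv /=; apply/andP; split.
    by rewrite !mulr_ge0 ?invr_ge0 ?exprn_ge0 ?pi_ge0 ?ler0n.
  have -> : j.*2.+1%:R * (2 * pi / 2 ^+ (m + 2)) =
            (j.*2.+1%:R / 2 ^+ m.+1) * pi :> R.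
    by rewrite addn2 exprS; field; rewrite expf_neq0.
  rewrite ler_piMl ?pi_ge0 // ler_pdivrMr ?exprn_gt0 // mul1r -natrX ler_nat.
  by rewrite expnS mul2n ltn_double.
have uniq_rs : uniq rs.
  rewrite map_inj_in_uniq ?iota_uniq // => i j.
  rewrite !mem_iota /= !add0n => lti ltj /(congr1 iota); rewrite !iota_r.
  have n2 : 2 != 0 :> R by rewrite pnatr_eq0.
  have nth : 2 * pi / 2 ^+ (m + 2) != 0 :> R.
    by rewrite !mulf_neq0 ?invr_neq0 ?expf_neq0 // gt_eqF // pi_gt0.
  move/(mulfI n2)/(cos_inj (ang_itv _ lti) (ang_itv _ ltj))/(mulIf nth).
  by move/eqP; rewrite eqr_nat => /eqP[] /double_inj.
have split_L : splitting_field_axiom L.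
  exists (map_poly (in_alg L) (chebQ m)); first exact: Qin.
  exists rs.
    rewrite [X in X %= _](@all_roots_prod_XsubC _ _ rs).
    - by rewrite eqp_scale // lead_coef_eq0 map_poly_eq0.
    - by rewrite size_map_poly (chebQ_size m).1 size_map size_iota.
    - by apply/allP => _ /mapP[j _ ->].
    - by rewrite uniq_rootsE.
  apply/eqP; rewrite eqEsubv subvf -gen_x.
  apply/FadjoinP; split; first exact: sub1v.
  have -> : x = r 0%N.
    by apply: inj_iota; rewrite iota_r iotax mul1r.
  by apply/seqv_sub_adjoin/map_f; rewrite mem_iota /= expn_gt0.
pose mix := FieldExt_isSplittingField.Build rat L split_L.
pose S : splittingFieldType rat := HB.pack L mix.
by exists S, iota, x.
Qed.

End QXExistence.

(** [QX R m] is the abstract field Q(X_m); [QXr] embeds it in [R] and sends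
    the generator [QXgen R m] to [X_ R m]. *)
Definition QX (R : realType) (m : nat) : splittingFieldType rat :=
  projT1 (QX_exists R m).

Definition QXr (R : realType) (m : nat) : {rmorphism QX R m -> R} :=
  projT1 (projT2 (QX_exists R m)).

Definition QXgen (R : realType) (m : nat) : QX R m :=
  s2val (projT2 (projT2 (QX_exists R m))).

Arguments QXr {R m}.

Lemma QXr_gen (R : realType) (m : nat) : QXr (QXgen R m) = X_ R m.
Proof. exact: (s2valP (projT2 (projT2 (QX_exists R m)))). Qed.

Lemma QX_adjoin (R : realType) (m : nat) : <<1; QXgen R m>>%VS = fullv.
Proof. exact: (s2valP' (projT2 (projT2 (QX_exists R m)))). Qed.

Notation GalQX R m := (gal_of {:QX R m}).

Lemma GalQXE (R : realType) (m : nat) :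
  ('Gal({:QX R m} / 1))%g = [set: GalQX R m]%SET.
Proof. by apply/setP=> x; rewrite gal_kHom ?sub1v // k1HomE ahomWin inE. Qed.

(** Z[X_m] as a subset of the reals, and as a subset of [QX R m]. *)
Definition ZX (R : realType) (m : nat) : set R :=
  [set x | exists P : {poly int}, x = (map_poly intr P).[X_ R m]]%classic.

Arguments ZX : clear implicits.

Definition ZQX (R : realType) (m : nat) : set (QX R m) :=
  (QXr @^-1` ZX R m)%classic.

Definition dvdZX (R : realType) (m : nat) (x y : QX R m) : Prop :=
  exists2 z, ZQX z & y = z * x.

(** For [x] in Z[X_n], [pq n x] is the unique pair [(p, q)] of elements of
    Z[X_(n-1)] such that [x = p + X_n q]. *)
Definition pq (R : realType) (n : nat) (x : R) : QX R n.-1 * QX R n.-1 :=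
  xget (0, 0)
    [set u | [/\ ZQX u.1, ZQX u.2 & x = QXr u.1 + X_ R n * QXr u.2]]%classic.

Lemma X_sqr (R : realType) (m : nat) : X_ R m.+1 ^+ 2 = 2 + X_ R m.
Proof.
rewrite /X_; set t := 2 * pi / 2 ^+ (m.+1 + 2).
have -> : 2 * pi / 2 ^+ (m + 2) = t *+ 2.
  rewrite /t addSn [2 ^+ (m + 2).+1]exprS -mulr_natl.
  by field; rewrite expf_neq0.
by rewrite cos_mulr2n; ring.
Qed.

Lemma pqP (R : realType) (n : nat) (x : R) : (1 <= n)%N -> ZX R n x ->
  [/\ ZQX (pq n x).1, ZQX (pq n x).2 &
      x = QXr (pq n x).1 + X_ R n * QXr (pq n x).2].
Proof.
case: n => // n _ [P ->].
suff [u uP] : exists u : QX R n * QX R n, [/\ ZQX u.1, ZQX u.2 &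
    (map_poly intr P).[X_ R n.+1] = QXr u.1 + X_ R n.+1 * QXr u.2].
  by rewrite /pq; case: xgetP => [v -> [] //|/(_ u)[]].
elim/poly_ind: P => [|P c [[p q] /= [[A Ap] [B Bq] E]]].
  exists (0, 0); split=> /=; last by rewrite rmorph0 horner0 rmorph0 mulr0 addr0.
    by exists 0; rewrite !rmorph0 horner0.
  by exists 0; rewrite !rmorph0 horner0.
exists (q * (2 + QXgen R n) + c%:~R, p); split=> /=.
- exists (B * (2%:P + 'X) + c%:P).
  rewrite !(rmorphD, rmorphM) /= !map_polyC map_polyX /= Bq QXr_gen.
  by rewrite !(hornerD, hornerM, hornerC, hornerX) rmorph_int rmorph1.
- by exists A.
- rewrite rmorphD rmorphM /= map_polyX map_polyC /=.
  rewrite hornerMXaddC E !(rmorphD, rmorphM) /= QXr_gen rmorph_int rmorph1.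
  by rewrite -X_sqr; ring.
Qed.

Definition pcoef (R : realType) (n : nat) (x : R) : QX R n.-1 := (pq n x).1.
Definition qcoef (R : realType) (n : nat) (x : R) : QX R n.-1 := (pq n x).2.

Definition RE (R : realType) (n : nat) : set R :=
  [set x | ZX R n x /\
     QXr (pcoef n x) ^+ 2 - X_ R n ^+ 2 * QXr (qcoef n x) ^+ 2 = 1]%classic.

Arguments RE : clear implicits.

(** [sigX sigma] is sigma(X_n), and [sig_ext sigma x] is sigma(x) for [x] in
    Z[X_n]. *)
Definition sigX (R : realType) (n : nat) (sigma : GalQX R n.-1) : R :=
  Num.sqrt (2 + QXr (sigma (QXgen R n.-1))).

Definition sig_ext (R : realType) (n : nat) (sigma : GalQX R n.-1) (x : R) : R :=
  QXr (sigma (pcoef n x)) + sigX sigma * QXr (sigma (qcoef n x)).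

Definition mu (R : realType) (m : nat) (x : QX R m) : {ffun GalQX R m -> R} :=
  [ffun sigma : GalQX R m => QXr (sigma x)].

Definition mu_s (R : realType) (n : nat) (s : {ffun GalQX R n.-1 -> R}) :
    {ffun GalQX R n.-1 -> R} :=
  [ffun sigma => s sigma * sigX sigma].

Definition l2norm (R : realType) (I : finType) (v : {ffun I -> R}) : R :=
  Num.sqrt (\sum_i v i ^+ 2).

Definition sign_vector (R : realType) (I : finType) (s : {ffun I -> R}) : Prop :=
  forall i, s i = 1 \/ s i = -1.

(** [a] attains the minimum of [|| mu_s(X_n) - mu(a') ||] over Z[X_(n-1)]. *)
Definition closest (R : realType) (n : nat) (s : {ffun GalQX R n.-1 -> R})
    (a : QX R n.-1) : Prop :=
  ZQX a /\
  forall a', ZQX a' -> l2norm (mu_s s - mu a) <= l2norm (mu_s s - mu a').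

Definition bcst (R : realType) (n : nat) (s : {ffun GalQX R n.-1 -> R})
    (a : QX R n.-1) (sigma : GalQX R n.-1) : R :=
  2 * sigX sigma / `|s sigma * sigX sigma - QXr (sigma a)|.

Definition Ccst (R : realType) (n : nat) (s : {ffun GalQX R n.-1 -> R})
    (a : QX R n.-1) (sigma : GalQX R n.-1) : R :=
  ln (Num.sqrt (bcst s a sigma ^+ 2 + 1) + `|bcst s a sigma|).

(* Main.v *)
(** Write [p - 1 = z q].  The Pell equation [p^2 - X_n^2 q^2 = 1] then reads
    [q (X_n^2 - z^2) = 2 z], and at every embedding sigma the sign of sigma(z)
    is that of sigma(p q), i.e. s_sigma.  Hence
    [|q| |s X_n - z| (X_n + |z|) = 2 |z|], so [|q| <= 2 / |s X_n - z|] at every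
    sigma.  Since [a_s] is at least as close to [s X_n] as [z] in Euclidean norm,
    some coordinate satisfies [|s X_n - a_s| <= |s X_n - z|], and there
    [|X_n q| <= b_(s,sigma)].  Finally [|log |p + X_n q||] is at most
    [log (sqrt (w^2 + 1) + |w|)] with [w = X_n q].

    The denominator of [b_(s,sigma)] must not vanish (in Rocq [b] would then be
    0): otherwise [a_s^2 = 2 + X_(n-1)], so that [X_n], of degree [2^n] by
    Eisenstein's criterion, would lie in a field of degree at most [2^(n-1)]. *)
Require Import Defs.
From mathcomp Require Import all_boot all_order all_algebra all_field.
From mathcomp Require Import all_classical all_reals all_analysis.
From mathcomp Require Import ring lra.

Import Order.TTheory GRing.Theory Num.Theory.

Local Open Scope ring_scope.

(** This is the shape needed for Eisenstein's criterion at 2: the coefficients below the leading one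
    are even and the constant one is 2 modulo 4. *)
Lemma chebQ_congr4 m : exists t : {poly int},
  chebQ m.+1 = map_poly intr ('X^(2 ^ m.+1) + (4 *: t - 2%:P)).
Proof.
elim: m => [|m [t IH]].
  exists 0; rewrite scaler0 sub0r /= rmorphB /= map_polyXn map_polyC /= expn1.
  by rewrite rmorph_nat.
(* Read off from squaring ['X^N + 2 (2 t - 1)] with [N = 2 ^ m.+1]: the cross term and the last
   square both carry a factor 4. *)
exists ('X^(2 ^ m.+1) * (2 *: t - 1) + (2 *: t - 1) ^+ 2).
rewrite [chebQ _]/= -/(chebQ m.+1) IH.
have -> : 2%:P = map_poly intr (2%:P : {poly int}) :> {poly rat}.
  by rewrite map_polyC /= rmorph_nat.
have -> : 'X^(2 ^ m.+2) = 'X^(2 ^ m.+1) ^+ 2 :> {poly int}.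
  by rewrite -exprM -expnSr.
rewrite -rmorphXn -rmorphB -!mul_polyC; congr map_poly.
rewrite !rmorph_nat; ring.
Qed.

Lemma chebQ_irreducible m : irreducible_poly (chebQ m.+1).
Proof.
have [t Et] := chebQ_congr4 m.
have [szQ monQ] := chebQ_size m.+1.
move: Et; set q := (X in map_poly _ X) => Et.
have szq : size q = (2 ^ m.+1).+1.
  by rewrite -szQ Et (size_map_inj_poly (@intr_inj rat)).
have lq : lead_coef q = 1.
  apply: (@intr_inj rat); rewrite -(lead_coef_map_inj (@intr_inj rat)) // -Et.
  exact/eqP.
rewrite Et; apply/irreducible_rat_int/(@eisenstein_crit 2) => //.
- by rewrite szq eqSS -lt0n expn_gt0.
- by rewrite lq.
- have -> : q`_0 = 4 * t`_0 - 2.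
    by rewrite !coefE ltn_eqF ?expn_gt0 // add0r.
  by rewrite rpredBl ?dvdz_mulr.
- move=> i; rewrite szq /= => lti; rewrite !coefE (ltn_eqF lti) add0r.
  by rewrite rpredB //; [exact/dvdz_mulr | case: (i == 0)].
Qed.

Lemma rmorph_horner_in_alg (L : fieldExtType rat) (R : realType)
    (tau : {rmorphism L -> R}) (q : {poly rat}) (y : L) :
  tau (map_poly (in_alg L) q).[y] = (map_poly ratr q).[tau y].
Proof.
rewrite -horner_map -map_poly_comp; congr horner.
by apply: eq_map_poly => c; exact: (fmorph_eq_rat (tau \o in_alg L)).
Qed.

(** [chebQ m] is the m-th iterate of [x^2 - 2]; its definition peels off the outermost copy, and
    this recursion the innermost one. *)
Lemma chebQ_horner_sqr (K : comNzRingType) (f : {rmorphism rat -> K}) m (x : K) :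
  (map_poly f (chebQ m.+1)).[x] = (map_poly f (chebQ m)).[x ^+ 2 - 2].
Proof.
have chebS k (z : K) :
    (map_poly f (chebQ k.+1)).[z] = (map_poly f (chebQ k)).[z] ^+ 2 - 2.
  rewrite rmorphB rmorphXn /= map_polyC /= rmorph_nat.
  by rewrite hornerD hornerN hornerC horner_exp.
elim: m x => [|m IH] x; first by rewrite chebS /= map_polyX !hornerX.
by rewrite chebS IH [RHS]chebS.
Qed.

(** The map [x^2 - 2] preserves the region [|x| >= 2], so its iterates never reach 0 from there.
    Hence 2 plus any real conjugate of the generator is positive and [sigX] is a genuine square
    root. *)
Lemma chebQ_root_lt2 (R : realType) m (x : R) :
  root (map_poly ratr (chebQ m)) x -> `|x| < 2.
Proof.
rewrite rootE; apply: contraTT; rewrite -leNgt.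
elim: m x => [|m IH] x x2.
  by rewrite map_polyX hornerX -normr_gt0 (lt_le_trans _ x2).
rewrite chebQ_horner_sqr IH // (le_trans _ (ler_norm _)) //.
by rewrite -real_normK ?num_real //; nra.
Qed.

Lemma root_chebQ_QXgen (R : realType) m :
  root (map_poly (in_alg _) (chebQ m)) (QXgen R m).
Proof.
rewrite rootE -(fmorph_eq0 (@QXr R m)) rmorph_horner_in_alg QXr_gen /X_ chebQ_cos.
have -> : 2 ^+ m * (2 * pi / 2 ^+ (m + 2)) = pi / 2 :> R.
  by rewrite exprD; field; rewrite expf_neq0.
by rewrite cos_pihalf mulr0.
Qed.

Lemma adjoin_degree_root_chebQ (L : fieldExtType rat) m (x : L) :
  root (map_poly (in_alg L) (chebQ m)) x -> (adjoin_degree 1 x <= 2 ^ m)%N.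
Proof.
move=> rx; have [szQ monQ] := chebQ_size m.
have Q1 : map_poly (in_alg L) (chebQ m) \is a polyOver 1%VS.
  by apply/polyOver1P; exists (chebQ m).
rewrite -ltnS -size_minPoly -szQ -(size_map_poly (in_alg L)).
by rewrite dvdp_leq ?minPoly_dvdp // map_poly_eq0 monic_neq0.
Qed.

Lemma adjoin_degree_root_chebQS (L : fieldExtType rat) m (x : L) :
  root (map_poly (in_alg L) (chebQ m.+1)) x -> adjoin_degree 1 x = (2 ^ m.+1)%N.
Proof.
move=> rx; have [_ irrQ] := chebQ_irreducible m; have [szQ monQ] := chebQ_size m.+1.
have Q1 : map_poly (in_alg L) (chebQ m.+1) \is a polyOver 1%VS.
  by apply/polyOver1P; exists (chebQ m.+1).
have [q Eq] := polyOver1P (minPolyOver 1 x).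
have sq : size q = (adjoin_degree 1 x).+1.
  by rewrite -size_minPoly Eq size_map_poly.
have /eqp_size : q %= chebQ m.+1.
  apply: irrQ; first by rewrite sq eqSS -lt0n.
  by rewrite -(dvdp_map (in_alg L)) -Eq minPoly_dvdp.
by rewrite sq szQ => -[].
Qed.

(** By the inner recursion a square root [y] would be a root of [chebQ m.+1], hence of degree
    [2 ^ m.+1], too large for a field generated by a root of [chebQ m]. *)
Lemma QXgen_add2_nonsquare (R : realType) m (y : QX R m) :
  y ^+ 2 != 2 + QXgen R m.
Proof.
apply/eqP => Ey.
have Eg : QXgen R m = y ^+ 2 - 2 by rewrite Ey addrC addKr.
have ry : root (map_poly (in_alg _) (chebQ m.+1)) y.
  by rewrite rootE chebQ_horner_sqr -Eg -rootE root_chebQ_QXgen.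
have := adjoin_degree_root_chebQ _ _ _ (root_chebQ_QXgen R m).
have degE (x : QX R m) : adjoin_degree 1 x = \dim <<1; x>>.
  by rewrite dim_Fadjoin dimv1 muln1.
rewrite degE QX_adjoin leqNgt (@leq_trans (adjoin_degree 1 y)) //.
  by rewrite (adjoin_degree_root_chebQS _ _ _ ry) ltn_exp2l.
by rewrite degE dimvS ?subvf.
Qed.

(** Both [|p + w|] and [|p - w|] are at most [M], and their product is 1, so [|p + w|] also is at
    least [M^-1]. *)
Lemma norm_ln_norm_le (R : realType) (p w b : R) : p ^+ 2 - w ^+ 2 = 1 ->
  `|w| <= b -> `|ln `|p + w| | <= ln (Num.sqrt (b ^+ 2 + 1) + `|b|).
Proof.
move=> pw1 wb; have b0 : 0 <= b by rewrite (le_trans _ wb).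
rewrite (ger0_norm b0); set M := _ + b.
have wb2 : w ^+ 2 <= b ^+ 2 by rewrite -real_normK ?num_real // lerXn2r ?nnegrE.
have pM : `|p| + `|w| <= M.
  by rewrite lerD // -sqrtr_sqr ler_sqrt; nra.
have M0 : 0 < M.
  by rewrite ltr_pwDl // sqrtr_gt0; nra.
have leM u : u ^+ 2 = w ^+ 2 -> `|p + u| <= M.
  move=> Eu; rewrite (le_trans (ler_normD _ _)) //.
  by rewrite -(sqrtr_sqr u) Eu sqrtr_sqr.
have prod1 : `|p + w| * `|p - w| = 1.
  by rewrite -normrM mulrC -subr_sqr pw1 normr1.
have pw0 : 0 < `|p + w|.
  rewrite lt_def normr_ge0 andbT; apply: contra_eq_neq prod1 => ->.
  by rewrite mul0r eq_sym oner_neq0.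
rewrite ler_norml; apply/andP; split; last by rewrite ler_ln ?posrE // leM.
rewrite -lnV ?posrE // ler_ln ?posrE ?invr_gt0 //.
rewrite -div1r ler_pdivrMr // -prod1 ler_pM2l //.
by rewrite leM // sqrrN.
Qed.

Lemma exists_norm_le_of_l2norm_le (R : realType) (I : finType)
    (u v : {ffun I -> R}) (i0 : I) :
  l2norm u <= l2norm v -> exists i, `|u i| <= `|v i|.
Proof.
rewrite /l2norm ler_sqrt; last by apply: sumr_ge0 => i _; exact: sqr_ge0.
move=> uv; apply/existsP; apply: contraLR uv => /existsPn vu.
(* Strictness of the sum needs a nonempty index set, whence [i0]. *)
rewrite -ltNge ltr_sum //; first by apply/hasP; exists i0; rewrite ?mem_index_enum.
move=> i _; rewrite -(real_normK (num_real (v i))) -(real_normK (num_real (u i))).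
by rewrite ltrXn2r ?nnegrE // ltNge vu.
Qed.

Lemma norm_mul_dist_le2 (R : realType) (p q y z : R) :
  0 < y -> q != 0 -> p ^+ 2 - y ^+ 2 * q ^+ 2 = 1 -> p - 1 = z * q ->
  `|q| * `|Num.sg (p * q) * y - z| <= 2.
Proof.
move=> y0 q0 pell pz.
have Ep : p = 1 + z * q by rewrite -pz addrC subrK.
have qyz : q * (y ^+ 2 - z ^+ 2) = 2 * z.
  apply: (mulfI q0); apply/eqP; rewrite -subr_eq0; apply/eqP.
  rewrite -(subrr 1) -[X in 1 - X]pell Ep; ring.
have p1 : 1 <= p ^+ 2 by rewrite -pell; nra.
have q2 : 0 < q ^+ 2 by rewrite exprn_even_gt0.
have p0 : p != 0 by apply: contraTneq p1 => ->; rewrite expr0n -ltNge.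
have [pq|pq|pq] := ltgtP 0 (p * q).
- have z0 : 0 <= z.
    rewrite -(pmulr_lge0 _ q2).
    have [q_gt|q_le] := ltP 0 q; nra.
  have yz : 0 < y + z by lra.
  (* Multiplying by [y + z] turns the left side into [|q (y^2 - z^2)| = 2 z], which is at most
     [2 (y + z)]. *)
  rewrite gtr0_sg // mul1r -normrM -(ler_pM2r yz).
  by rewrite -{1}(gtr0_norm yz) -normrM -mulrA -subr_sqr qyz ger0_norm; lra.
- have z0 : z <= 0.
    rewrite -(pmulr_lle0 _ q2).
    have [q_gt|q_le] := ltP 0 q; nra.
  have yz : 0 < y - z by lra.
  rewrite ltr0_sg // mulN1r -opprD normrN -normrM -(ler_pM2r yz).
  rewrite -{1}(gtr0_norm yz) -normrM -mulrA [_ * (y - z)]mulrC -subr_sqr qyz.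
  by rewrite ler0_norm; lra.
- by move/esym/eqP: pq; rewrite mulf_eq0 (negPf p0) (negPf q0).
Qed.

Theorem theorem5p1 (R : realType) (n : nat) (n_ge1 : (1 <= n)%N)
    (a : {ffun GalQX R n.-1 -> R} -> QX R n.-1)
    (a_closest : forall s, sign_vector s -> closest s (a s))
    (eps : R) (eps_RE : RE R n eps)
    (q_dvd : dvdZX (qcoef n eps) (pcoef n eps - 1))
    (pq_gt0 : 0 < QXr (pcoef n eps) * QXr (qcoef n eps)) :
  let s := [ffun sigma : GalQX R n.-1 =>
              Num.sg (QXr (sigma (pcoef n eps * qcoef n eps)))] in
  exists sigma : GalQX R n.-1,
    `| ln `| sig_ext sigma eps | | <= Ccst s (a s) sigma.
Proof.
move=> s; case: eps_RE => _ pell; case: q_dvd => z Zz pz.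
have X2 : X_ R n ^+ 2 = 2 + X_ R n.-1 by rewrite -X_sqr prednK.
(* The Pell equation is pulled back from the reals to the abstract field, where every [sigma] can be
   applied to it. *)
have {pell X2} : pcoef n eps ^+ 2 - (2 + QXgen R n.-1) * qcoef n eps ^+ 2 = 1.
  apply: (fmorph_inj (@QXr R n.-1)); rewrite rmorph1 -pell X2.
  by rewrite rmorphB rmorphXn rmorphM rmorphXn rmorphD /= rmorph_nat QXr_gen.
rewrite {}/s /sig_ext.
move: (pcoef n eps) (qcoef n eps) pz pq_gt0 => p q pz pq_gt0 pell.
have /andP[p0 q0] : (p != 0) && (q != 0).
  by rewrite -negb_or -mulf_eq0 -(fmorph_eq0 (@QXr R n.-1)) rmorphM gt_eqF.
set s := [ffun sigma => _].
pose tau (sigma : GalQX R n.-1) : {rmorphism QX R n.-1 -> R} := QXr \o sigma.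
have tau_gen sigma : sigX sigma ^+ 2 = 2 + tau sigma (QXgen R n.-1) /\ 0 < sigX sigma.
  have : `|tau sigma (QXgen R n.-1)| < 2.
    apply: (@chebQ_root_lt2 _ n.-1); rewrite rootE -rmorph_horner_in_alg.
    by rewrite (eqP (root_chebQ_QXgen R n.-1)) rmorph0.
  rewrite ltr_norml => /andP[lo _].
  have pos : 0 < 2 + tau sigma (QXgen R n.-1) by lra.
  by rewrite /sigX sqr_sqrtr ?sqrtr_gt0 // ltW.
have s_sign : sign_vector s.
  move=> sigma; rewrite ffunE.
  (* [Num.sg] takes the value 0 at 0, which must be excluded. *)
  have : tau sigma (p * q) != 0 by rewrite fmorph_eq0 mulf_neq0.
  by move=> /= nz; case: sgrP nz => // _ _; [left | right].
have [_ /(_ z Zz) min_a] := a_closest s s_sign.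
have [sigma le_az] :=
  exists_norm_le_of_l2norm_le _ _ _ _ (1%g : GalQX R n.-1) min_a.
have sE : s sigma = Num.sg (tau sigma p * tau sigma q) by rewrite ffunE !rmorphM.
have {le_az} le_az : `|s sigma * sigX sigma - tau sigma (a s)| <=
    `|s sigma * sigX sigma - tau sigma z|.
  by move: le_az; rewrite sE !ffunE !rmorphM.
exists sigma; rewrite /Ccst -/(tau sigma p) -/(tau sigma q).
have [Y2 Y0] := tau_gen sigma.
have pell_s : tau sigma p ^+ 2 - sigX sigma ^+ 2 * tau sigma q ^+ 2 = 1.
  have := congr1 (tau sigma) pell.
  by rewrite rmorphB rmorphXn rmorphM rmorphXn rmorphD rmorph_nat -Y2 rmorph1.
have pz_s : tau sigma p - 1 = tau sigma z * tau sigma q.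
  by rewrite -rmorphM -pz rmorphB rmorph1.
have qs0 : tau sigma q != 0 by rewrite fmorph_eq0.
have := norm_mul_dist_le2 _ _ _ _ _ Y0 qs0 pell_s pz_s.
rewrite -sE => le2.
have dist_gt0 : 0 < `|s sigma * sigX sigma - tau sigma (a s)|.
  (* Squaring removes the sign [s sigma], and injectivity of [tau sigma] brings the equality back to
     the field. *)
  rewrite normr_gt0; apply: contra_neq (QXgen_add2_nonsquare R _ (a s)).
  move/subr0_eq => Ea; apply: (fmorph_inj (tau sigma)).
  rewrite rmorphXn -Ea exprMn rmorphD rmorph_nat -Y2.
  by case: (s_sign sigma) => ->; rewrite ?sqrrN expr1n mul1r.
apply: norm_ln_norm_le; first by rewrite exprMn.
(* After cancelling [sigX sigma], the claim is [le2] with [z] replaced by the closer point [a s]. *)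
rewrite /bcst ler_pdivlMr // normrM (gtr0_norm Y0) -mulrA [leRHS]mulrC.
rewrite ler_pM2l //.
by rewrite (le_trans _ le2) // ler_wpM2l.
Qed.
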